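(* For every integer $d \geq 1$ and every prime $p$, there exists an extraordinary $p$-adic Lie group of dimension $d$.
   Context: A $p$-adic Lie group is a Lie group over the field $\mathbf{Q}_p$ of $p$-adic numbers. The quasi-center $\mathrm{QZ}(G)$ of a topological group $G$ is the subgroup consisting of all elements of $G$ that centralize some open subgroup of $G$; for a $p$-adic Lie group, it is the kernel of the adjoint representation $\mathrm{Ad}_G\colon G\to \mathrm{GL}(L(G))$ on the Lie algebra $L(G)$. A $p$-adic Lie group $G$ is called extraordinary if it satisfies all of the following: (a) every closed subnormal subgroup of $G$ is open or discrete; (b) the adjoint action of $G$ is trivial (i.e., $G=\mathrm{QZ}(G)$); (c) the derived subgroup $[H,H]$ of each open subnormal subgroup $H\leqslant G$ is non-discrete. *)

(* Defs.v *)
From HB Require Import structures.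
From mathcomp Require Import all_boot all_order all_algebra.
From mathcomp Require Import generic_quotient ring_quotient.
From mathcomp Require Import all_classical.
From mathcomp Require Import topology.

Set Implicit Arguments.
Unset Strict Implicit.
Unset Printing Implicit Defensive.

Import Order.TTheory GRing.Theory Num.Theory.

Local Open Scope classical_set_scope.
Local Open Scope ring_scope.
Local Open Scope quotient_scope.

(** * The p-adic absolute value on the rationals *)

(* If p is not prime then [logn p] is constantly 0, so that [padic_abs p] is
   the trivial absolute value: no primality hypothesis is needed below. *)
Definition padic_absz (p : nat) (a : int) : rat :=
  if a == 0 then 0 else (p ^ logn p `|a|%N)%:R^-1.

Definition padic_abs (p : nat) (x : rat) : rat :=
  padic_absz p (numq x) / padic_absz p (denq x).

Section PadicAbs.
Variable p : nat.
Local Notation absz := (padic_absz p).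
Local Notation abs := (padic_abs p).

Let pX_gt0 (a : int) : (0 < p ^ logn p `|a|)%N.
Proof.
have [pp|npp] := boolP (prime p); first by rewrite expn_gt0 prime_gt0.
by rewrite /logn (negbTE npp).
Qed.

Lemma padic_absz_gt0 a : a != 0 -> 0 < absz a.
Proof. by move=> a0; rewrite /padic_absz (negbTE a0) invr_gt0 ltr0n. Qed.

Lemma padic_abszM a b : absz (a * b) = absz a * absz b.
Proof.
rewrite /padic_absz mulf_eq0.
case: eqP => [|/eqP a0]; first by rewrite mul0r.
case: eqP => [|/eqP b0]; first by rewrite mulr0.
by rewrite /= abszM lognM ?absz_gt0// expnD natrM invfM.
Qed.

Lemma padic_abszN a : absz (- a) = absz a.
Proof. by rewrite /padic_absz oppr_eq0 abszN. Qed.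

Lemma padic_abszD a b : absz (a + b) <= Num.max (absz a) (absz b).
Proof.
have [pp|npp] := boolP (prime p); last first.
  rewrite /padic_absz /logn (negbTE npp) expn0 invr1 le_max.
  case: (a =P 0) => [->|_]; last by case: ifP.
  rewrite add0r; case: (b =P 0) => [//|_]; by rewrite orbT.
wlog le_ab : a b / absz a <= absz b => [H|].
  by case/orP: (le_total (absz a) (absz b)) => /H//; rewrite addrC maxC.
rewrite le_max; apply/orP; right.
have absz_ge0 c : 0 <= absz c.
  by rewrite /padic_absz; case: ifP => // _; rewrite invr_ge0.
move: le_ab; rewrite {1 2}/padic_absz.
case: (a =P 0) => [->|/eqP a0]; first by rewrite add0r.
case: (b =P 0) => [->|/eqP b0].
  by rewrite invr_le0 lern0 -leqn0 leqNgt pX_gt0.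
rewrite lef_pV2 ?posrE ?ltr0n ?pX_gt0// ler_nat leq_exp2l ?prime_gt1// => le_ba.
rewrite {1}/padic_absz; case: eqP => [//|/eqP ab0].
rewrite /padic_absz (negbTE b0).
rewrite lef_pV2 ?posrE ?ltr0n ?pX_gt0// ler_nat leq_exp2l ?prime_gt1//.
rewrite -pfactor_dvdn ?absz_gt0//.
have : ((p ^ logn p `|b|)%:Z %| a + b)%Z.
  by rewrite rpredD// dvdzE /= pfactor_dvdn ?absz_gt0.
by rewrite dvdzE.
Qed.

Lemma padic_abs_frac (a b : int) : b != 0 ->
  abs (a%:~R / b%:~R) = absz a / absz b.
Proof.
move=> b0; set x : rat := _ / _; rewrite /padic_abs.
have : (numq x * b = a * denq x)%R.
  apply: (@intr_inj rat); rewrite !rmorphM /=.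
  by rewrite numqE /x mulrAC divfK ?intr_eq0.
move/(congr1 absz); rewrite !padic_abszM => E.
apply/eqP; rewrite eqr_div ?lt0r_neq0 ?padic_absz_gt0 ?denq_neq0//.
by rewrite E.
Qed.

Lemma padic_abs0 : abs 0 = 0.
Proof. by rewrite /padic_abs /padic_absz eqxx mul0r. Qed.

Lemma padic_abs_gt0 x : x != 0 -> 0 < abs x.
Proof.
by move=> x0; rewrite divr_gt0// padic_absz_gt0 ?denq_neq0 ?numq_eq0.
Qed.

Lemma padic_abs_ge0 x : 0 <= abs x.
Proof.
by have [->|/padic_abs_gt0/ltW//] := eqVneq x 0; rewrite padic_abs0.
Qed.

Lemma padic_absM x y : abs (x * y) = abs x * abs y.
Proof.
rewrite -{1}[x]divq_num_den -{1}[y]divq_num_den mulf_div -!rmorphM /=.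
by rewrite padic_abs_frac ?mulf_neq0 ?denq_neq0// !padic_abszM -mulf_div.
Qed.

Lemma padic_abs1 : abs 1 = 1.
Proof.
have := padic_abs_gt0 (oner_neq0 rat); have := padic_absM 1 1.
rewrite mulr1 => E a0; apply: (mulfI (lt0r_neq0 a0)).
by rewrite -E mulr1.
Qed.

Lemma padic_absN x : abs (- x) = abs x.
Proof. by rewrite /padic_abs numqN denqN padic_abszN. Qed.

Lemma padic_absV x : abs x^-1 = (abs x)^-1.
Proof.
have [->|x0] := eqVneq x 0; first by rewrite invr0 padic_abs0 invr0.
have ax := lt0r_neq0 (padic_abs_gt0 x0).
by apply: (mulfI ax); rewrite -padic_absM !mulfV// padic_abs1.
Qed.

Lemma padic_absD x y : abs (x + y) <= Num.max (abs x) (abs y).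
Proof.
rewrite -{1}[x]divq_num_den -{1}[y]divq_num_den.
have dx := denq_neq0 x; have dy := denq_neq0 y.
rewrite addf_div ?intr_eq0// -!rmorphM /= -rmorphD /=.
rewrite padic_abs_frac ?mulf_neq0//.
rewrite ler_pdivrMr ?padic_absz_gt0 ?mulf_neq0//.
apply: le_trans (padic_abszD _ _) _.
have numE z : absz (numq z) = abs z * absz (denq z).
  by rewrite divfK// lt0r_neq0// padic_absz_gt0 ?denq_neq0.
have xy0 : 0 <= absz (denq x) * absz (denq y).
  by rewrite ltW// mulr_gt0// padic_absz_gt0.
rewrite !padic_abszM maxr_pMl// !numE.
by rewrite -!mulrA [absz (denq y) * _]mulrC.
Qed.

Lemma padic_absB x y : abs (x - y) <= Num.max (abs x) (abs y).
Proof. by rewrite -(padic_absN y) padic_absD. Qed.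

Lemma padic_abs_eq x y : abs (x - y) < abs y -> abs x = abs y.
Proof.
move=> xy; apply/eqP; rewrite eq_le; apply/andP; split.
  rewrite -[x](subrK y); apply: le_trans (padic_absD _ _) _.
  by rewrite ge_max lexx (ltW xy).
have := padic_absB x (x - y); rewrite subKr le_max => /orP[//|].
by rewrite leNgt xy.
Qed.

End PadicAbs.

(** * The field of p-adic numbers: Cauchy sequences modulo null sequences *)

Section PadicSequences.
Variable p : nat.
Local Notation abs := (padic_abs p).

Definition padic_cauchy : pred (nat -> rat) := fun u =>
  `[< forall e : rat, 0 < e -> exists N, forall m n,
      (N <= m)%N -> (N <= n)%N -> abs (u m - u n) < e >].

Definition padic_null : pred (nat -> rat) := fun u =>
  `[< forall e : rat, 0 < e -> exists N, forall n,
      (N <= n)%N -> abs (u n) < e >].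

Lemma padic_cauchy_stable u : u \in padic_cauchy -> u \notin padic_null ->
  exists2 r, 0 < r & exists N, forall n, (N <= n)%N -> abs (u n) = r.
Proof.
move=> /asboolP cu /asboolPn /existsNP[e /not_implyP[e0 nu]].
have [N cN] := cu _ e0.
have [n [Nn en]] : exists n, (N <= n)%N /\ e <= abs (u n).
  apply: contrapT => H; apply: nu; exists N => n Nn.
  by rewrite ltNge; apply/negP => en; apply: H; exists n.
exists (abs (u n)); first exact: lt_le_trans en.
exists N => m Nm; apply: padic_abs_eq; apply: lt_le_trans en; exact: cN.
Qed.

Lemma padic_cauchy_bounded u : u \in padic_cauchy ->
  exists2 M, 0 < M & exists N, forall n, (N <= n)%N -> abs (u n) <= M.
Proof.
move=> cu; have [/asboolP nu|nu] := boolP (u \in padic_null).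
  have [N H] := nu 1 ltr01; exists 1 => //; exists N => n /H; exact: ltW.
have [r r0 [N H]] := padic_cauchy_stable cu nu.
by exists r => //; exists N => n /H ->.
Qed.

Lemma padic_cauchy_subring : subring_closed padic_cauchy.
Proof.
split.
- by apply/asboolP => e e0; exists 0%N => m n _ _; rewrite subrr padic_abs0.
- move=> u v /asboolP cu /asboolP cv; apply/asboolP => e e0.
  have [N1 H1] := cu _ e0; have [N2 H2] := cv _ e0.
  exists (maxn N1 N2) => m n; rewrite !geq_max => /andP[m1 m2] /andP[n1 n2].
  have -> : (u - v) m - (u - v) n = (u m - u n) - (v m - v n).
    rewrite -[(u - v) m]/(u m - v m) -[(u - v) n]/(u n - v n).
    by rewrite opprD addrACA -opprD.
  by apply: le_lt_trans (padic_absB _ _ _) _; rewrite gt_max H1 ?H2.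
- move=> u v cu cv; apply/asboolP => e e0.
  have [M1 M10 [K1 B1]] := padic_cauchy_bounded cu.
  have [M2 M20 [K2 B2]] := padic_cauchy_bounded cv.
  move: cu cv => /asboolP cu /asboolP cv.
  have [N1 H1] := cu _ (divr_gt0 e0 M20).
  have [N2 H2] := cv _ (divr_gt0 e0 M10).
  exists (maxn (maxn N1 N2) (maxn K1 K2)) => m n.
  rewrite !geq_max => /andP[/andP[m1 m2] /andP[m3 m4]].
  move=> /andP[/andP[n1 n2] /andP[n3 n4]].
  have -> : (u * v) m - (u * v) n = (u m - u n) * v m + u n * (v m - v n).
    rewrite -[(u * v) m]/(u m * v m) -[(u * v) n]/(u n * v n).
    by rewrite mulrBl mulrBr addrA subrK.
  apply: le_lt_trans (padic_absD _ _ _) _; rewrite gt_max !padic_absM.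
  apply/andP; split.
    have := H1 _ _ m1 n1; rewrite ltr_pdivlMr//; apply: le_lt_trans.
    by rewrite ler_wpM2l ?padic_abs_ge0 ?B2.
  have := H2 _ _ m2 n2; rewrite ltr_pdivlMr// mulrC; apply: le_lt_trans.
  by rewrite ler_wpM2r ?padic_abs_ge0 ?B1.
Qed.

HB.instance Definition _ :=
  GRing.isSubringClosed.Build (nat -> rat) padic_cauchy padic_cauchy_subring.

Record padicSeq := PadicSeq {
  padicSeq_val :> nat -> rat;
  padicSeqP : padicSeq_val \in padic_cauchy }.

HB.instance Definition _ := [isSub for padicSeq_val].
HB.instance Definition _ := [Choice of padicSeq by <:].
HB.instance Definition _ := [SubChoice_isSubComNzRing of padicSeq by <:].

Definition padic_null_ideal : pred padicSeq := fun u => val u \in padic_null.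

Lemma padic_null_idealr : idealr_closed padic_null_ideal.
Proof.
split.
- apply/asboolP => e e0; exists 0%N => n _.
  by rewrite -[val 0]/(0 : nat -> rat) padic_abs0.
- apply/asboolP => /(_ 1 ltr01)[N /(_ N (leqnn N))].
  by rewrite -[val 1]/(1 : nat -> rat) padic_abs1 ltxx.
- move=> a u v nu /asboolP nv; apply/asboolP => e e0.
  have [M M0 [K B]] := padic_cauchy_bounded (padicSeqP a).
  move/asboolP: nu => nu.
  have [N1 H1] := nu _ (divr_gt0 e0 M0); have [N2 H2] := nv _ e0.
  exists (maxn K (maxn N1 N2)) => n; rewrite !geq_max => /and3P[nK n1 n2].
  rewrite -[val _ n]/(val a n * val u n + val v n).
  apply: le_lt_trans (padic_absD _ _ _) _; rewrite gt_max H2// andbT padic_absM.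
  have := H1 _ n1; rewrite ltr_pdivlMr// mulrC; apply: le_lt_trans.
  by rewrite ler_wpM2r ?padic_abs_ge0 ?B.
Qed.

HB.instance Definition _ :=
  isIdealr.Build padicSeq padic_null_ideal padic_null_idealr.

Local Notation quotT := {ideal_quot (padic_null_ideal : idealr padicSeq)}.

Definition Qp : Type := quotT.

HB.instance Definition _ := Choice.on Qp.
HB.instance Definition _ := GRing.ComNzRing.on Qp.

Definition Qp_class (u : padicSeq) : Qp := \pi_quotT u.

Definition Qp_repr (x : Qp) : padicSeq :=
  repr (x : quotT).

Lemma Qp_reprK : cancel Qp_repr Qp_class.
Proof. by move=> x; rewrite /Qp_class /Qp_repr reprK. Qed.

Lemma Qp_classE u v : (Qp_class u == Qp_class v) = (val (u - v) \in padic_null).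
Proof. by rewrite /Qp_class -Quotient.idealrBE. Qed.

Lemma Qp_class0 : Qp_class 0 = 0.
Proof. exact: rmorph0. Qed.

Lemma Qp_class1 : Qp_class 1 = 1.
Proof. exact: rmorph1. Qed.

Lemma Qp_classN : {morph Qp_class : u / - u}.
Proof. exact: rmorphN. Qed.

Lemma Qp_classD : {morph Qp_class : u v / u + v}.
Proof. exact: rmorphD. Qed.

Lemma Qp_classM : {morph Qp_class : u v / u * v}.
Proof. exact: rmorphM. Qed.

Lemma Qp_class_eq0 u : (Qp_class u == 0) = (val u \in padic_null).
Proof. by rewrite -Qp_class0 Qp_classE subr0. Qed.

Lemma padic_cauchy_inv (u : padicSeq) : val u \notin padic_null ->
  (fun n => (u n)^-1) \in padic_cauchy.
Proof.
move=> nu; have [r r0 [N H]] := padic_cauchy_stable (padicSeqP u) nu.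
have /asboolP cu := padicSeqP u; apply/asboolP => e e0.
have [K HK] := cu _ (mulr_gt0 e0 (mulr_gt0 r0 r0)).
have un0 n : (N <= n)%N -> u n != 0.
  by move=> /H; case: eqP => // -> E; rewrite -E padic_abs0 ltxx in r0.
exists (maxn N K) => m n; rewrite !geq_max => /andP[m1 m2] /andP[n1 n2].
have -> : (u m)^-1 - (u n)^-1 = (u n - u m) / (u m * u n).
  rewrite mulrBl invfM mulrCA mulfV ?un0// mulr1; congr (_ - _).
  by rewrite mulrA mulfV ?un0// mul1r.
rewrite padic_absM padic_absV padic_absM !H// ltr_pdivrMr ?mulr_gt0//.
exact: HK.
Qed.

Definition Qp_inv (x : Qp) : Qp :=
  if @idP (val (Qp_repr x) \notin padic_null) is ReflectT nx
  then Qp_class (PadicSeq (padic_cauchy_inv nx)) else 0.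

Lemma Qp_mulVf x : x != 0 -> Qp_inv x * x = 1.
Proof.
rewrite /Qp_inv -{1}[x]Qp_reprK Qp_class_eq0.
case: {-}_ / idP => // nx _; set w := PadicSeq _.
have -> : Qp_class w * x = Qp_class (w * Qp_repr x).
  by rewrite Qp_classM Qp_reprK.
apply/eqP; rewrite -Qp_class1 Qp_classE; apply/asboolP => e e0.
have [r r0 [N H]] := padic_cauchy_stable (padicSeqP _) nx.
exists N => n /H; set u := Qp_repr x => un.
have un0 : u n != 0 by apply: contraTN r0 => /eqP E; rewrite -un E padic_abs0 ltxx.
rewrite -[val _ n]/((u n)^-1 * u n - 1).
by rewrite mulVf// subrr padic_abs0.
Qed.

Lemma Qp_inv0 : Qp_inv 0 = 0.
Proof.
rewrite /Qp_inv; case: {-}_ / idP => // n0; case/negP: (n0).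
by rewrite -Qp_class_eq0 Qp_reprK.
Qed.

HB.instance Definition _ := GRing.ComNzRing_isField.Build Qp Qp_mulVf Qp_inv0.

(** The absolute value of a class is the limit of the absolute values along a
    representative. If that sequence of values is not eventually constant then
    the class is 0, which is why [xget] defaults to 0. *)
Definition Qp_abs (x : Qp) : rat :=
  xget 0 [set r | exists N, forall n, (N <= n)%N -> abs (Qp_repr x n) = r].

Lemma Qp_abs_class (u : padicSeq) r :
  (exists N, forall n, (N <= n)%N -> abs (u n) = r) -> Qp_abs (Qp_class u) = r.
Proof.
move=> [N H]; rewrite /Qp_abs; set v := Qp_repr _.
have : Qp_class v = Qp_class u by rewrite Qp_reprK.
move/eqP; rewrite Qp_classE => /asboolP uv.
have vE : 0 < r -> exists K, forall n, (K <= n)%N -> abs (v n) = r.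
  move=> r0; have [K HK] := uv _ r0; exists (maxn N K) => n.
  rewrite geq_max => /andP[/H un /HK vn].
  by rewrite -un; apply: padic_abs_eq; rewrite un.
have r_ge0 : 0 <= r by rewrite -(H N)// padic_abs_ge0.
case: xgetP => [s _ [K HK]|noS].
  move: r_ge0; rewrite le_eqVlt => /predU1P[r0|/vE[L HL]]; last first.
    by rewrite -(HK (maxn K L)) ?leq_maxl// HL ?leq_maxr.
  apply/eqP; rewrite -r0 eq_le; apply/andP; split; last first.
    by rewrite -(HK K)// padic_abs_ge0.
  rewrite leNgt; apply/negP => s0; have [L HL] := uv _ s0.
  pose n := maxn N (maxn K L).
  have nL : (L <= n)%N by rewrite !leq_max leqnn !orbT.
  have nK : (K <= n)%N by rewrite !leq_max leqnn !orbT.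
  have nN : (N <= n)%N by rewrite !leq_max leqnn.
  have := HL _ nL; rewrite -[val _ n]/(v n - u n) => vun.
  have := padic_absD p (v n - u n) (u n); rewrite subrK HK// H// -r0.
  by rewrite leNgt gt_max vun s0.
move: r_ge0; rewrite le_eqVlt => /predU1P[//|/vE H'].
by have := noS r.
Qed.

Lemma Qp_abs0 : Qp_abs 0 = 0.
Proof.
by rewrite -Qp_class0; apply: Qp_abs_class; exists 0%N => n _; exact: padic_abs0.
Qed.

Lemma Qp_abs_stable x : exists N, forall n, (N <= n)%N ->
  x != 0 -> abs (Qp_repr x n) = Qp_abs x /\ 0 < Qp_abs x.
Proof.
have [->|x0] := eqVneq x 0; first by exists 0%N.
have nx : val (Qp_repr x) \notin padic_null by rewrite -Qp_class_eq0 Qp_reprK.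
have [r r0 [N H]] := padic_cauchy_stable (padicSeqP _) nx.
have E : Qp_abs x = r by rewrite -[x]Qp_reprK; apply: Qp_abs_class; exists N.
by exists N => n /H ->; rewrite E.
Qed.

Lemma Qp_abs_eq0 x : (Qp_abs x == 0) = (x == 0).
Proof.
have [->|x0] := eqVneq x 0; first by rewrite Qp_abs0 eqxx.
by have [N /(_ N (leqnn N) x0)[_ /lt0r_neq0/negbTE]] := Qp_abs_stable x.
Qed.

Lemma Qp_abs_ge0 x : 0 <= Qp_abs x.
Proof.
have [->|x0] := eqVneq x 0; first by rewrite Qp_abs0.
by have [N /(_ N (leqnn N) x0)[_ /ltW]] := Qp_abs_stable x.
Qed.

Lemma Qp_absN x : Qp_abs (- x) = Qp_abs x.
Proof.
have [->|x0] := eqVneq x 0; first by rewrite oppr0.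
rewrite -{1}[x]Qp_reprK -Qp_classN; apply: Qp_abs_class.
have [N H] := Qp_abs_stable x; exists N => n /H/(_ x0)[<- _].
exact: padic_absN.
Qed.

Lemma Qp_absM x y : Qp_abs (x * y) = Qp_abs x * Qp_abs y.
Proof.
have [->|x0] := eqVneq x 0; first by rewrite mul0r Qp_abs0 mul0r.
have [->|y0] := eqVneq y 0; first by rewrite mulr0 Qp_abs0 mulr0.
rewrite -{1}[x]Qp_reprK -{1}[y]Qp_reprK -Qp_classM; apply: Qp_abs_class.
have [N H] := Qp_abs_stable x; have [K L] := Qp_abs_stable y.
exists (maxn N K) => n; rewrite geq_max => /andP[/H/(_ x0)[<- _]].
by move=> /L/(_ y0)[<- _]; exact: padic_absM.
Qed.

Lemma Qp_absD x y : Qp_abs (x + y) <= Num.max (Qp_abs x) (Qp_abs y).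
Proof.
have [->|x0] := eqVneq x 0; first by rewrite add0r le_max lexx orbT.
have [->|y0] := eqVneq y 0; first by rewrite addr0 le_max lexx.
have [->|xy0] := eqVneq (x + y) 0; first by rewrite Qp_abs0 le_max Qp_abs_ge0.
have nxy : val (Qp_repr x + Qp_repr y) \notin padic_null.
  by rewrite -Qp_class_eq0 Qp_classD !Qp_reprK.
have [r r0 [M HM]] := padic_cauchy_stable (padicSeqP _) nxy.
have -> : Qp_abs (x + y) = r.
  rewrite -{1}[x]Qp_reprK -{1}[y]Qp_reprK -Qp_classD.
  by apply: Qp_abs_class; exists M.
have [N H] := Qp_abs_stable x; have [K L] := Qp_abs_stable y.
pose n := maxn M (maxn N K).
have nM : (M <= n)%N by rewrite !leq_max leqnn.
have nN : (N <= n)%N by rewrite !leq_max leqnn !orbT.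
have nK : (K <= n)%N by rewrite !leq_max leqnn !orbT.
have [<- _] := H _ nN x0; have [<- _] := L _ nK y0; rewrite -(HM _ nM).
exact: padic_absD.
Qed.

Let cst_cauchy (q : rat) : cst q \in padic_cauchy.
Proof.
by apply/asboolP => e e0; exists 0%N => m n _ _; rewrite subrr padic_abs0.
Qed.

Let Qp_cst (q : rat) : Qp := Qp_class (PadicSeq (cst_cauchy q)).

Let Qp_cst_zmod : zmod_morphism Qp_cst.
Proof.
move=> a b; rewrite /Qp_cst -Qp_classN -Qp_classD; congr Qp_class.
exact/val_inj.
Qed.

Let Qp_cst_monoid : monoid_morphism Qp_cst.
Proof.
split=> [|a b]; first by rewrite -Qp_class1; congr Qp_class; exact/val_inj.
by rewrite /Qp_cst -Qp_classM; congr Qp_class; exact/val_inj.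
Qed.

HB.instance Definition _ := GRing.isZmodMorphism.Build rat Qp Qp_cst Qp_cst_zmod.
HB.instance Definition _ :=
  GRing.isMonoidMorphism.Build rat Qp Qp_cst Qp_cst_monoid.

Lemma Qp_abs_ratr q : Qp_abs (ratr q) = abs q.
Proof.
by rewrite -(fmorph_eq_rat Qp_cst); apply: Qp_abs_class; exists 0%N.
Qed.

Let Qp_dist (x y : Qp) : rat := Qp_abs (x - y).

Let Qp_distxx x : Qp_dist x x = 0.
Proof. by rewrite /Qp_dist subrr Qp_abs0. Qed.

Let Qp_dist_eq0 x y : Qp_dist x y = 0 -> x = y.
Proof. by move/eqP; rewrite Qp_abs_eq0 subr_eq0 => /eqP. Qed.

Let Qp_distC x y : Qp_dist x y = Qp_dist y x.
Proof. by rewrite /Qp_dist -opprB Qp_absN. Qed.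

Let Qp_dist_triangle y x z : Qp_dist x z <= Qp_dist x y + Qp_dist y z.
Proof.
rewrite /Qp_dist -[x - z](subrKA y); apply: le_trans (Qp_absD _ _) _.
by rewrite ge_max lerDl lerDr !Qp_abs_ge0.
Qed.

HB.instance Definition _ := isMetric.Build rat Qp
  Qp_distxx Qp_dist_eq0 Qp_distC Qp_dist_triangle.

End PadicSequences.

(** * Analytic maps between open subsets of finite powers of Q_p *)

Section Analytic.
Variable p : nat.
Local Notation K := (Qp p).

Definition Qp_vnorm n (x : 'rV[K]_n) : rat :=
  \big[Num.max/0]_(i < n) Qp_abs (x 0 i).

(** The power series with coefficients [c] (indexed by multi-indices in n
    variables) converges to [g] on the open polydisc of radius r centred at 0.
    The bound on the coefficients makes the family of its terms tend to 0 at
    each point of the polydisc, so that it is summable and its sum is the limit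
    of the sums over the boxes {0, ..., N - 1} ^ n. *)
Definition has_power_series n (g : 'rV[K]_n -> K) (c : ('I_n -> nat) -> K)
    (r : rat) : Prop :=
  (exists M : rat, forall a : 'I_n -> nat,
     Qp_abs (c a) * r ^+ (\sum_(i < n) a i)%N <= M) /\
  (forall h : 'rV[K]_n, Qp_vnorm h < r ->
     (fun N : nat => \sum_(a : {ffun 'I_n -> 'I_N})
        c (fun i => a i : nat) * \prod_(i < n) h 0 i ^+ a i) @ \oo --> g h).

(** [f] is only relevant near [x]. *)
Definition analytic_at n m (f : 'rV[K]_n -> 'rV[K]_m) (x : 'rV[K]_n) : Prop :=
  forall j : 'I_m, exists (c : ('I_n -> nat) -> K) (r : rat),
    0 < r /\ has_power_series (fun h => f (x + h) 0 j) c r.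

(** The differential of [f] at [x] is the linear map h |-> h *m A. *)
Definition has_differential n m (f : 'rV[K]_n -> 'rV[K]_m) (x : 'rV[K]_n)
    (A : 'M[K]_(n, m)) : Prop :=
  forall e : rat, 0 < e -> exists2 r : rat, 0 < r &
    forall h : 'rV[K]_n, Qp_vnorm h < r ->
      Qp_vnorm (f (x + h) - f x - h *m A) <= e * Qp_vnorm h.

End Analytic.

(** * Topological groups *)

HB.mixin Record isTopologicalGroup G & Group G & Topological G := {
  mulg_continuous : continuous (fun xy : G * G => (xy.1 * xy.2)%g);
  invg_continuous : continuous (fun x : G => x^-1%g)
}.

#[short(type="topologicalGroupType")]
HB.structure Definition TopologicalGroup :=
  {G of Group G & Topological G & isTopologicalGroup G}.

Section Subgroups.
Variable G : topologicalGroupType.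
Implicit Types A H K : set G.

Definition is_subgroup H : Prop :=
  [/\ H 1%g, (forall x y, H x -> H y -> H (x * y)%g)
    & forall x, H x -> H x^-1%g].

Definition normal_in H K : Prop :=
  H `<=` K /\ forall x k, H x -> K k -> H (x ^ k)%g.

Inductive subnormal : set G -> Prop :=
| subnormal_refl : subnormal setT
| subnormal_step H K of
    subnormal K & is_subgroup H & normal_in H K : subnormal H.

Definition generated A : set G :=
  [set x | forall H, is_subgroup H -> A `<=` H -> H x].

Definition derived_subgroup H : set G :=
  generated [set z | exists x y, [/\ H x, H y & z = [~ x, y]%g]].

(** The subspace topology on [A] is discrete. *)
Definition discrete_subset A : Prop := A `<=` isolated A.

Definition quasi_center : set G :=
  [set g | exists U : set G, [/\ open U, is_subgroup U
     & forall u, U u -> commute g u]].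

End Subgroups.

Arguments quasi_center G : clear implicits.

(** * p-adic Lie groups *)

(** A chart of [G] with values in Q_p^d: a homeomorphism, with inverse
    [chart_inv], from the open set [chart_dom] to an open subset of Q_p^d. *)
Record Qp_chart (p d : nat) (G : topologicalType) := QpChart {
  chart_dom : set G;
  chart_fun :> G -> 'rV[Qp p]_d;
  chart_inv : 'rV[Qp p]_d -> G;
  chart_dom_open : open chart_dom;
  chart_im_open : open (chart_fun @` chart_dom);
  chart_funK : forall x, chart_dom x -> chart_inv (chart_fun x) = x;
  chart_fun_continuous :
    forall x, chart_dom x -> {for x, continuous chart_fun};
  chart_inv_continuous :
    forall x, chart_dom x -> {for chart_fun x, continuous chart_inv}
}.

(** A Lie group over Q_p of dimension d. Since the group operations are
    continuous and analyticity is local, it is enough that each expression in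
    charts of an operation be analytic at each point where it makes sense. *)
Record padicLieGroup (p d : nat) := PadicLieGroup {
  lie_carrier :> topologicalGroupType;
  lie_atlas : set (Qp_chart p d lie_carrier);
  lie_atlas_cover : forall x : lie_carrier,
    exists2 c, lie_atlas c & chart_dom c x;
  lie_atlas_compat : forall c1 c2, lie_atlas c1 -> lie_atlas c2 ->
    forall x, chart_dom c1 x -> chart_dom c2 x ->
    analytic_at (fun v => c2 (chart_inv c1 v)) (c1 x);
  lie_mul_analytic : forall c1 c2 c3,
    lie_atlas c1 -> lie_atlas c2 -> lie_atlas c3 ->
    forall x y, chart_dom c1 x -> chart_dom c2 y -> chart_dom c3 (x * y)%g ->
    analytic_at (fun v : 'rV[Qp p]_(d + d) =>
        c3 (chart_inv c1 (lsubmx v) * chart_inv c2 (rsubmx v))%g)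
      (row_mx (c1 x) (c2 y));
  lie_inv_analytic : forall c1 c2, lie_atlas c1 -> lie_atlas c2 ->
    forall x, chart_dom c1 x -> chart_dom c2 x^-1%g ->
    analytic_at (fun v => c2 (chart_inv c1 v)^-1%g) (c1 x)
}.

(** In the chart [c] at 1, which identifies the Lie algebra (the tangent space
    at 1) with Q_p^d, the adjoint action of [g] is given by the matrix [A]: it
    is the differential at 1 of the conjugation x |-> g x g^-1. *)
Definition is_adjoint_matrix p d (G : padicLieGroup p d) (c : Qp_chart p d G)
    (g : G) (A : 'M[Qp p]_d) : Prop :=
  has_differential (fun v => c (g * chart_inv c v * g^-1)%g) (c 1%g) A.

Definition trivial_adjoint p d (G : padicLieGroup p d) : Prop :=
  forall (g : G) (c : Qp_chart p d G), lie_atlas c -> chart_dom c 1%g ->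
    is_adjoint_matrix c g 1%:M.

(** Both formulations of the second condition are required; they are equivalent
    because the quasi-center is the kernel of the adjoint representation. *)
Record extraordinary p d (G : padicLieGroup p d) : Prop := Extraordinary {
  extraordinary_closed : forall H : set G, closed H -> is_subgroup H ->
    subnormal H -> open H \/ discrete_subset H;
  extraordinary_adjoint : trivial_adjoint G;
  extraordinary_quasi_center : quasi_center G = setT;
  extraordinary_derived : forall H : set G, open H -> is_subgroup H ->
    subnormal H -> ~ discrete_subset (derived_subgroup H)
}.

(* Main.v *)
Require Import Defs.
From HB Require Import structures.
From mathcomp Require Import all_boot all_order all_algebra.
From mathcomp Require Import all_classical topology.

(** Let [W = Q_p^d]. Suppose that [W] is a subgroup of an abstractly simple
    group [G] and that each element of [G] centralizes a ball of [W] around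
    0. Declare the balls of [W] to be a base of neighbourhoods of 1 in [G].
    This is a group topology, precisely because each element of [G] commutes
    with a small ball ([model_group_mulg_continuous]), and for the same
    reason the group operations are affine in the charts given by the cosets
    of [W] ([coset_mul_analytic]) and conjugations are trivial near 1
    ([model_lie_trivial_adjoint]). So [G] is a Lie group of dimension [d]
    equal to its quasi-center. By simplicity a subnormal subgroup is trivial
    or equal to [G] ([model_lie_subnormal]), and the derived subgroup of [G]
    is [G] ([derived_full]), which is not discrete because [Q_p^d] has
    arbitrarily small nonzero vectors.

    The simple group is a group of permutations. Let [V] be an abelian group
    with a decreasing sequence of subgroups [F n] that intersect in 0, and
    let [G] consist of the permutations of [V] that commute with the
    translations by some [F n]. Translations by [V] belong to [G], and if
    [W] is a subgroup of [V] in which each [F n] contains a ball, then each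
    element of [G] centralizes a ball of [W].

    Assume that each [F n] contains infinitely many disjoint copies of [V],
    on all of which translations by some common [F m] act compatibly
    ([absorbing]). Then [G] is simple ([normal_full]), by the classical
    argument for groups of homeomorphisms. A nontrivial [h] in a normal
    subgroup [H] moves a small coset off itself; if [a] and [b] are
    supported in that coset, then [[~ a, b] = [~ [~ a^-1, h], b]] lies in
    [H]. An infinite product over the copies of [V] in the coset shows that
    each [g] fixing some coset pointwise is conjugate to such a commutator
    ([commg_conj_coset]). Finally each element of [G] is a product of two
    elements that fix a coset pointwise.

    For [V] one takes the product of [W] with an infinite power of a group
    so large that the whole of [V] embeds in it as a set
    ([model_absorbing]). *)

Set Implicit Arguments.
Unset Strict Implicit.
Unset Printing Implicit Defensive.

Import Order.TTheory GRing.Theory Num.Theory.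

Local Open Scope classical_set_scope.
Local Open Scope ring_scope.

(** * Generalities *)

(** If [c] is the conjugate of [a^-1] by some [h] and has support disjoint from
    those of [a] and [b], this says that [[~ [~ a^-1, h], b] = [~ a, b]], so a
    normal subgroup containing [h] contains the commutator of [a] and [b]. *)
Lemma commg_disjoint (G : groupType) (a b c : G) :
  commute c a -> commute c b -> [~ a * c, b]%g = [~ a, b]%g.
Proof.
move=> ca cb; rewrite !commgEl conjMg.
have -> : (c ^ b = c)%g by apply/conjg_fixP/commgP.
have cab : commute c (a^-1 * a ^ b)%g.
  apply: commuteM; [exact: commuteV|rewrite conjgE].
  by apply: commuteM; [exact: commuteV|exact: commuteM].
by rewrite invgM mulgA -[(c^-1 * a^-1 * _)%g]mulgA -mulgA -cab mulKg.
Qed.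

Lemma sval_inj (T : Type) (P : T -> Prop) : injective (@proj1_sig T P).
Proof.
move=> [x px] [y py] /= xy; subst y.
by congr exist; exact: Prop_irrelevance.
Qed.

(** * Locally equivariant permutations of a filtered group *)

(** A separated filtration of an abelian group by subgroups: a base of
    neighbourhoods of 0 for a Hausdorff group topology. *)
Record filtration (V : zmodType) := Filtration {
  level :> nat -> set V;
  level0 : forall n, level n 0;
  levelB : forall n x y, level n x -> level n y -> level n (x - y);
  level_decr : forall m n, (m <= n)%N -> level n `<=` level m;
  level_sep : forall x, (forall n, level n x) -> x = 0
}.

Section FiltrationTheory.
Variables (V : zmodType) (F : filtration V).

Lemma levelN n x : F n x -> F n (- x).
Proof. by move=> Fx; rewrite -sub0r; apply: levelB => //; apply: level0. Qed.

Lemma levelD n x y : F n x -> F n y -> F n (x + y).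
Proof.
by move=> Fx Fy; rewrite -[y]opprK; apply: levelB => //; apply: levelN.
Qed.

Definition equivariant n (f : V -> V) :=
  forall x o, F n o -> f (x + o) = f x + o.

Lemma equivariantW m n f : (m <= n)%N -> equivariant m f -> equivariant n f.
Proof. by move=> mn fE x o /(level_decr mn)/fE. Qed.

End FiltrationTheory.

(** The permutations of [V] that commute with the translations by some open
    subgroup. The inverse is a field so that inverses need no choice; by
    [lperm_ext] it is determined by the permutation. *)
Record lperm (V : zmodType) (F : filtration V) := Lperm {
  lperm_fun :> V -> V;
  lperm_inv : V -> V;
  lperm_funK : cancel lperm_fun lperm_inv;
  lperm_invK : cancel lperm_inv lperm_fun;
  lperm_equivariant : exists n, equivariant F n lperm_fun
}.

HB.instance Definition _ (V : zmodType) (F : filtration V) :=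
  gen_eqMixin (lperm F).
HB.instance Definition _ (V : zmodType) (F : filtration V) :=
  gen_choiceMixin (lperm F).

Section LpermGroup.
Variables (V : zmodType) (F : filtration V).
Implicit Types f g h : lperm F.

Lemma lperm_ext f g : f =1 g -> f = g.
Proof.
case: f g => [f f' fK f'K fE] [g g' gK g'K gE] /= /funext fg.
subst g; have gf : g' = f' by apply/funext => x; rewrite -[in LHS](f'K x) gK.
by subst g'; congr Lperm; exact: Prop_irrelevance.
Qed.

Lemma lperm_id_equivariant : exists n, equivariant F n id.
Proof. by exists 0%N. Qed.

Definition lperm_one : lperm F :=
  @Lperm V F id id (fun=> erefl) (fun=> erefl) lperm_id_equivariant.

Lemma lperm_mul_equivariant f g : exists n, equivariant F n (f \o g).
Proof.
have [m fE] := lperm_equivariant f; have [n gE] := lperm_equivariant g.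
exists (maxn m n) => x o Fo /=.
by rewrite gE ?fE//; apply: level_decr Fo; rewrite (leq_maxr, leq_maxl).
Qed.

Definition lperm_mul f g : lperm F :=
  Lperm (can_comp (@lperm_funK _ _ f) (@lperm_funK _ _ g))
        (can_comp (@lperm_invK _ _ g) (@lperm_invK _ _ f))
        (lperm_mul_equivariant f g).

Lemma lperm_inv_equivariant f : exists n, equivariant F n (lperm_inv f).
Proof.
have [n fE] := lperm_equivariant f; exists n => x o Fo.
by apply: (can_inj (@lperm_funK _ _ f)); rewrite fE// !lperm_invK.
Qed.

Definition lperm_invg f : lperm F :=
  Lperm (@lperm_invK _ _ f) (@lperm_funK _ _ f) (lperm_inv_equivariant f).

Lemma lperm_mulA : associative lperm_mul.
Proof. by move=> f g h; apply: lperm_ext. Qed.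
Lemma lperm_mul1g : left_id lperm_one lperm_mul.
Proof. by move=> f; apply: lperm_ext. Qed.
Lemma lperm_mulg1 : right_id lperm_one lperm_mul.
Proof. by move=> f; apply: lperm_ext. Qed.
Lemma lperm_mulVg : left_inverse lperm_one lperm_invg lperm_mul.
Proof. by move=> f; apply: lperm_ext => x; exact: lperm_funK. Qed.
Lemma lperm_mulgV : right_inverse lperm_one lperm_invg lperm_mul.
Proof. by move=> f; apply: lperm_ext => x; exact: lperm_invK. Qed.

HB.instance Definition _ := isGroup.Build (lperm F)
  lperm_mulA lperm_mul1g lperm_mulg1 lperm_mulVg lperm_mulgV.

Lemma lpermM f g x : (f * g)%g x = f (g x). Proof. by []. Qed.
Lemma lpermK f : cancel f (f^-1)%g. Proof. exact: lperm_funK. Qed.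
Lemma lpermVK f : cancel (f^-1)%g f. Proof. exact: lperm_invK. Qed.
Lemma lperm_inj f : injective f. Proof. exact: can_inj (lpermK f). Qed.

Lemma lperm_neq1 f : f <> 1%g -> exists x, f x != x.
Proof.
move=> f1; apply: contrapT => H; apply: f1; apply: lperm_ext => x.
by apply/eqP/negPn/negP => fx; apply: H; exists x.
Qed.

Lemma translation_subproof v : exists n, equivariant F n (+%R v).
Proof. by exists 0%N => x o _; rewrite addrA. Qed.

Definition translation v : lperm F :=
  Lperm (addKr v) (addNKr v) (translation_subproof v).

Lemma translationE v x : translation v x = v + x. Proof. by []. Qed.

Lemma translationD u v :
  translation (u + v) = (translation u * translation v)%g.
Proof. by apply: lperm_ext => x; rewrite lpermM !translationE addrA. Qed.

Lemma translation0 : translation 0 = 1%g.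
Proof. by apply: lperm_ext => x; rewrite translationE add0r. Qed.

Lemma translationN v : translation (- v) = (translation v)^-1%g.
Proof. by apply: lperm_ext. Qed.

Lemma translation_inj : injective translation.
Proof. by move=> u v /(congr1 (fun f : lperm F => f 0)); rewrite /= !addr0. Qed.

(** As [V] is abelian, translations belong to the group, and a permutation
    equivariant at level [n] centralizes the translations by that level. This
    is what will make the quasi-center the whole group. *)
Lemma translation_commute n f v :
  equivariant F n f -> F n v -> commute f (translation v).
Proof.
move=> fE Fv; apply: lperm_ext => x.
by rewrite !lpermM !translationE [v + x]addrC fE// addrC.
Qed.

Section Lift.
Variables (T : Type) (J : T -> V).
Hypothesis J_inj : injective J.

Definition lift_fun (s : T -> T) (x : V) : V :=
  if pselect (exists t, J t = x) is left e then J (s (projT1 (cid e))) else x.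

Lemma lift_funE s t : lift_fun s (J t) = J (s t).
Proof.
rewrite /lift_fun; case: pselect => [e|[]]; last by exists t.
by case: cid => u /= /J_inj ->.
Qed.

Lemma lift_fun_out s x : ~ range J x -> lift_fun s x = x.
Proof.
move=> Jx; rewrite /lift_fun; case: pselect => // -[t tx].
by case: Jx; exists t.
Qed.

Lemma lift_funK s s' : cancel s s' -> cancel (lift_fun s) (lift_fun s').
Proof.
move=> sK x; have [[t _ <-]|Jx] := pselect (range J x).
  by rewrite !lift_funE sK.
by rewrite !lift_fun_out.
Qed.

(** A permutation [s] of a set [T] embedded in [V] by [J] is extended by the
    identity outside the range of [J]. It is enough to check equivariance on
    the range: the condition there makes the range a union of cosets, and the
    identity is equivariant on the complement. *)
Lemma lift_exists n s s' : cancel s s' -> cancel s' s ->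
  (forall t o, F n o ->
     exists2 t', J t' = J t + o & J (s t') = J (s t) + o) ->
  exists f : lperm F,
    (forall t, f (J t) = J (s t)) /\ (forall x, ~ range J x -> f x = x).
Proof.
move=> sK s'K sE.
suff fE : exists n, equivariant F n (lift_fun s).
  exists (Lperm (lift_funK sK) (lift_funK s'K) fE).
  by split=> [t|x]; [exact: lift_funE|exact: lift_fun_out].
exists n => x o Fo; have [[t _ <-]|Jx] := pselect (range J x).
  by have [t' <-] := sE t o Fo; rewrite !lift_funE.
rewrite !lift_fun_out// => -[t _ tx]; apply: Jx.
have [t' t'E _] := sE t _ (levelN Fo); exists t' => //.
by rewrite t'E tx addrK.
Qed.

End Lift.

Lemma swap_exists n (T : Type) (a b : T -> V) :
  injective a -> injective b -> (forall t u, a t <> b u) ->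
  (forall t o, F n o -> exists2 t', a t' = a t + o & b t' = b t + o) ->
  exists f : lperm F, [/\ forall t, f (a t) = b t, forall t, f (b t) = a t
    & forall x, ~ range a x -> ~ range b x -> f x = x].
Proof.
move=> a_inj b_inj ab abE.
pose J (t : bool * T) := if t.1 then a t.2 else b t.2.
pose s (t : bool * T) := (~~ t.1, t.2).
have J_inj : injective J.
  move=> [[] t] [[] u]; rewrite /J /=; first by move=> /a_inj ->.
  - by move=> /ab.
  - by move=> /esym/ab.
  - by move=> /b_inj ->.
have sK : cancel s s by move=> [c t]; rewrite /s /= negbK.
have [|f [fJ fout]] := @lift_exists _ J J_inj n _ _ sK sK.
  move=> [c t] o /(abE t)[t' ta tb].
  by case: c; rewrite /J /s /=; [exists (true, t')|exists (false, t')].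
exists f; split=> [t|t|x ax bx]; first exact: (fJ (true, t)).
- exact: (fJ (false, t)).
- by apply: fout => -[[[] t] _ tx]; [apply: ax|apply: bx]; exists t.
Qed.

End LpermGroup.

(** * Simplicity of the group of locally equivariant permutations *)

(** Every level, however small, contains infinitely many disjoint
    equivariant copies of the whole of [V]. They are indexed by [int] rather
    than [nat] so that moving each copy to the next one is a permutation. *)
Definition absorbing (V : zmodType) (F : filtration V) := forall n,
  exists (j : int -> V -> V) (m : nat),
    [/\ forall i v, F n (j i v),
        forall i i' v v', j i v = j i' v' -> i = i' /\ v = v'
      & forall i, equivariant F m (j i)].

Section Simplicity.
Variables (V : zmodType) (F : filtration V).
Hypothesis Fabs : absorbing F.
Implicit Types f g h : lperm F.

Definition fixes_coset n x g := forall y, F n (y - x) -> g y = y.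

Lemma disjoint_support_commute (E : set V) (a c : lperm F) :
  (forall x, ~ E x -> a x = x) -> (forall x, E x -> c x = x) -> commute c a.
Proof.
move=> aE cE; apply: lperm_ext => x; rewrite !lpermM.
have [Ex|nEx] := pselect (E x).
  rewrite (cE x)// cE//; apply: contrapT => Eax.
  by apply: (Eax); rewrite (lperm_inj (aE _ Eax)).
rewrite (aE x)// aE// => Ecx.
by apply: nEx; rewrite -(lperm_inj (cE _ Ecx)).
Qed.

(** An infinite-product trick: inside the small coset [x + F k] put copies
    of [V] indexed by the integers, let [a] act as [g] on the copies of positive
    index and let [b] move each copy to the next one. Then [~ a, b] acts as [g]
    on copy 0 and trivially elsewhere. Since [g] fixes the coset containing all
    the copies, exchanging the complement of the coset [x + F n] with its image
    in copy 0 conjugates [g] into that commutator. *)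
Lemma commg_conj_coset n x g : fixes_coset n x g -> forall k, (n <= k)%N ->
  exists a b s : lperm F, [/\ forall y, ~ F k (y - x) -> a y = y,
    forall y, ~ F k (y - x) -> b y = y & [~ a, b]%g = (g ^ s)%g].
Proof.
move=> gfix k nk; have [j [m [jF j_inj jE]]] := Fabs k.
have [l gE] := lperm_equivariant g.
pose J (t : int * V) := x + j t.1 t.2.
have J_inj : injective J by move=> [i v] [i' v'] /addrI /= /j_inj[-> ->].
have JE i v o : F m o -> J (i, v + o) = J (i, v) + o.
  by move=> Fo; rewrite /J /= jE// addrA.
have Jk t : F k (J t - x) by rewrite /J addrC addKr.
have Jout y : ~ F k (y - x) -> ~ range J y.
  by move=> ky [t _ ty]; apply: ky; rewrite -ty.
pose act (P : pred int) (h : V -> V) (t : int * V) :=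
  (t.1, if P t.1 then h t.2 else t.2).
have actK P (h h' : V -> V) : cancel h h' -> cancel (act P h) (act P h').
  by move=> hK [i v]; rewrite /act /=; case: (P i); rewrite ?hK.
have lift_act P : exists f : lperm F,
    (forall t, f (J t) = J (act P g t)) /\ (forall y, ~ range J y -> f y = y).
  apply: (@lift_exists _ _ _ J J_inj (maxn m l) (act P g) (act P (g^-1)%g)).
  - exact/actK/lpermK.
  - exact/actK/lpermVK.
  - move=> [i v] o Fo.
    have Fm : F m o by apply: level_decr Fo; exact: leq_maxl.
    have Fl : F l o by apply: level_decr Fo; exact: leq_maxr.
    exists (i, v + o); rewrite ?JE// /act /=.
    by case: ifP => _; rewrite ?gE// JE.
have [a [aJ aout]] := lift_act (fun i => 0 < i).
(* [c] acts as [g] on copy 0: it is both [~ a, b] and a conjugate of [g]. *)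
have [c [cJ cout]] := lift_act (fun i => i == 0).
have [b [bJ bout]] : exists f : lperm F,
    (forall t, f (J t) = J (t.1 + 1, t.2)) /\
    (forall y, ~ range J y -> f y = y).
  apply: (@lift_exists _ _ _ J J_inj m _ (fun t => (t.1 - 1, t.2))).
  - by move=> [i v] /=; rewrite addrK.
  - by move=> [i v] /=; rewrite subrK.
  - by move=> [i v] o Fo; exists (i, v + o); rewrite /= JE.
pose outside y := ~ F n (y - x); pose out := {y | outside y}.
have [||||s [s1 s2 s3]] :=
    @swap_exists _ F (maxn m n) out (fun v => sval v) (fun v => J (0, sval v)).
- exact: sval_inj.
- by move=> u v /J_inj[]; exact: sval_inj.
- by move=> [u nu] v /= uE; apply: nu; apply: (level_decr nk); rewrite uE.
- move=> [v nv] o Fo.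
  have Fm : F m o by apply: level_decr Fo; exact: leq_maxl.
  have Fn : F n o by apply: level_decr Fo; exact: leq_maxr.
  have nvo : ~ F n (v + o - x).
    by move=> Fv; apply: nv; have := levelB Fv Fn; rewrite addrAC addrK.
  by exists (exist outside _ nvo); rewrite //= JE.
exists a, b, (s^-1)%g; split.
- by move=> y /Jout/aout.
- by move=> y /Jout/bout.
have abc : (a * b = b * a * c)%g.
  apply: lperm_ext => y; rewrite !lpermM.
  have [[[i v] _ <-]|Jy] := pselect (range J y); last first.
    by rewrite (cout y)// (aout y)// (bout y)// aout.
  rewrite bJ cJ /= !aJ bJ /act /= ltzD1 le_eqVlt eq_sym.
  by case: eqP => [->|_] //=; rewrite ltxx.
have -> : [~ a, b]%g = c.
  by rewrite commgEl conjgE abc -!mulgA !mulKg.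
have sJ v : ~ F n (v - x) -> s v = J (0, v).
  by move=> nv; exact: (s1 (exist outside v nv)).
have Js v : ~ F n (v - x) -> s (J (0, v)) = v.
  by move=> nv; exact: (s2 (exist outside v nv)).
have cs : (c * s = s * g)%g.
  apply: lperm_ext => y; rewrite !lpermM.
  have [yn|ny] := pselect (F n (y - x)); last first.
    have ngy : ~ F n (g y - x).
      by move=> gyn; apply: ny; rewrite -(lperm_inj (gfix _ gyn)).
    by rewrite !sJ// cJ.
  rewrite (gfix _ yn).
  have [[v _ vy]|y0] := pselect (range (fun v : out => J (0, sval v)) y).
    by rewrite -vy s2 cout//; apply: Jout => /(level_decr nk); exact: (svalP v).
  rewrite s3//; last by move=> [[v nv] _ /= vy]; apply: nv; rewrite vy.
  have [[[i v] _ vy]|/cout//] := pselect (range J y).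
  rewrite -vy cJ /act /=; case: eqP => //= i0; subst i; congr J; congr pair.
  by apply: gfix; apply: contrapT => nv; apply: y0; exists (exist outside v nv).
by rewrite conjgE invgK mulgA -cs mulgK.
Qed.

(** Equivariance gives [h y = h x + (y - x)] for [y] close to [x], so [h]
    moves a whole coset of [x] off itself as soon as it moves [x]. *)
Lemma moved_coset n x h : h x != x ->
  exists2 k, (n <= k)%N & forall y, F k (y - x) -> ~ F k (h y - x).
Proof.
move=> hx; have [l hE] := lperm_equivariant h.
have [m Fm] : exists m, ~ F m (h x - x).
  by apply/existsNP => /level_sep/eqP; rewrite subr_eq0 (negbTE hx).
exists (maxn n (maxn l m)); first exact: leq_maxl.
move=> y Fy Fhy; apply: Fm; apply: (@level_decr _ F m (maxn n (maxn l m))).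
  by rewrite !leq_max leqnn !orbT.
have -> : h x - x = (h y - x) - (y - x).
  have -> : h y = h x + (y - x).
    rewrite -hE ?subrKC//; apply: level_decr Fy.
    by rewrite !leq_max leqnn !orbT.
  by rewrite addrAC addrK.
exact: levelB.
Qed.

(** Leaves room for the coset fixed by the permutation of [swap_cosets]. *)
Lemma third_point (u v : V) : exists z, z <> u /\ z <> v.
Proof.
have [j [_ [_ j_inj _]]] := Fabs 0.
have j12 : j 1 0 <> j 2 0 by move=> /j_inj[].
have j01 : j 0 0 <> j 1 0 by move=> /j_inj[].
have j02 : j 0 0 <> j 2 0 by move=> /j_inj[].
apply: contrapT => nz.
have uv i : j i 0 = u \/ j i 0 = v.
  by apply: contrapT => /not_orP ji; apply: nz; exists (j i 0).
by case: (uv 0) (uv 1) (uv 2) => H0 [] H1 [] H2;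
  move: j12 j01 j02; rewrite H0 H1 H2.
Qed.

(** Take a level small enough to separate the three points from each other. *)
Lemma swap_cosets l (u v z : V) : u <> v -> z <> u -> z <> v ->
  exists (n : nat) f, [/\ (l <= n)%N,
    forall o, F n o -> f (u + o) = v + o & fixes_coset n z f].
Proof.
move=> uv zu zv.
have sep x y : x <> y -> exists m, ~ F m (x - y).
  by move=> xy; apply/existsNP => /level_sep/eqP; rewrite subr_eq0 => /eqP.
have [m1 F1] := sep _ _ zu; have [m2 F2] := sep _ _ zv.
have [m3 F3] := sep _ _ uv.
pose n := maxn l (maxn m1 (maxn m2 m3)); exists n.
have nF m x : (m <= n)%N -> ~ F m x -> ~ F n x by move=> mn Fm /(level_decr mn).
have {}F1 : ~ F n (z - u) by apply: nF F1; rewrite !leq_max leqnn !orbT.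
have {}F2 : ~ F n (z - v) by apply: nF F2; rewrite !leq_max leqnn !orbT.
have {}F3 : ~ F n (u - v) by apply: nF F3; rewrite !leq_max leqnn !orbT.
pose a (t : {o | F n o}) := u + sval t; pose b (t : {o | F n o}) := v + sval t.
have [||||f [fa _ fout]] := @swap_exists _ F n _ a b.
- by move=> s t /addrI/sval_inj.
- by move=> s t /addrI/sval_inj.
- move=> [o Fo] [o' Fo']; rewrite /a /b /= => E; apply: F3.
  have -> : u - v = o' - o.
    by apply/eqP; rewrite subr_eq addrAC eq_sym subr_eq addrC E.
  exact: levelB.
- move=> [o Fo] o' Fo'; exists (exist (F n) _ (levelD Fo Fo')).
    by rewrite /a /= addrA.
  by rewrite /b /= addrA.
exists f; split; first exact: leq_maxl.
  by move=> o Fo; exact: (fa (exist (F n) o Fo)).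
move=> y Fy; have zE w o : F n o -> w + o = y -> F n (z - w).
  move=> Fo wo; have -> : z - w = o - (y - z); last exact: levelB.
  by rewrite -wo opprB opprD addrCA [- w - o]addrC addNKr.
by apply: fout => -[[o Fo] _ /(zE _ _ Fo)].
Qed.

(** A permutation commuting with all translations is a translation, and a
    swap of two cosets that fixes a third one is not. *)
Lemma lperm_noncommutative : exists f g : lperm F, ~ commute f g.
Proof.
have [v [v0 _]] := third_point 0 0; have [z [z0 zv]] := third_point 0 v.
have [n [f [_ f0 fz]]] := swap_cosets 0 (nesym v0) z0 zv.
exists f, (translation F z) => /(congr1 (fun h : lperm F => h 0)).
rewrite !lpermM !translationE addr0 fz; last by rewrite subrr; exact: level0.
rewrite -[in f 0](addr0 0) f0 ?addr0; last exact: level0.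
by rewrite -{1}[z]addr0 => /addrI/esym.
Qed.

Section NormalSubgroup.
Variable H : set (lperm F).
Hypothesis H1 : H 1%g.
Hypothesis HM : forall f g, H f -> H g -> H (f * g)%g.
Hypothesis HV : forall f, H f -> H (f^-1)%g.
Hypothesis HJ : forall f g, H f -> H (f ^ g)%g.

Let H_comm h g : H h -> H [~ h, g]%g.
Proof. by move=> Hh; rewrite commgEl; apply: HM; [exact: HV|exact: HJ]. Qed.

Let H_commr h g : H h -> H [~ g, h]%g.
Proof.
move=> Hh; have -> : [~ g, h]%g = (h^-1 ^ g * h)%g.
  by rewrite commgEl !conjgE !mulgA.
by apply: HM => //; apply/HJ/HV.
Qed.

(** A conjugate [h'] of [h] by a translation moves a small coset of [x] off
    itself. With [a] and [b] supported in that coset and [c] the conjugate of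
    [a^-1] by [h'], the commutator [~ a, b], which is a conjugate of [g], equals
    [[~ [~ a^-1, h'], b]] and so lies in [H]. *)
Lemma normal_fixes_coset n x g h :
  H h -> h <> 1%g -> fixes_coset n x g -> H g.
Proof.
move=> Hh0 /lperm_neq1[y hy] gfix.
pose u := translation F (y - x); pose h' := (h ^ u)%g.
have Hh : H h' by exact: HJ.
have hx : h' x != x.
  apply: contraNneq hy => /(congr1 u).
  rewrite -[u (h' x)]lpermM /h' conjgE mulVKg lpermM.
  by rewrite !translationE subrK => ->.
clearbody h'; have [k nk hk] := moved_coset n hx.
have [a [b [s [aE bE abE]]]] := commg_conj_coset gfix nk.
pose c := (a^-1 ^ h')%g.
have cE z : F k (z - x) -> c z = z.
  move=> /hk hz; rewrite /c conjgE !lpermM.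
  by rewrite -{1}(aE _ hz) !lpermK.
have ca : commute c a := disjoint_support_commute aE cE.
have cb : commute c b := disjoint_support_commute bE cE.
have Hac : H (a * c)%g by rewrite -{1}[a]invgK -commgEl; exact: H_commr.
by rewrite -(conjgK s g) -abE -(commg_disjoint ca cb); apply/HJ/H_comm.
Qed.

(** Every permutation [g] is a product of two permutations that fix a coset
    pointwise: if [g x != x], let [f] exchange small cosets of [x] and [g x];
    then [f] fixes a third coset, and [f^-1 g] fixes the coset of [x]. *)
Lemma normal_full h : H h -> h <> 1%g -> H = setT.
Proof.
move=> Hh h1; rewrite -subTset => g _.
have [->//|/lperm_neq1[x gx]] := pselect (g = 1%g).
have [l gE] := lperm_equivariant g.
have [z [zx zgx]] := third_point x (g x).
have [n [f [ln fE fz]]] := swap_cosets l (nesym (elimN eqP gx)) zx zgx.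
rewrite -(mulVKg f g); apply: HM; first exact: (@normal_fixes_coset n z f h).
apply: (@normal_fixes_coset n x _ h) => // y Fy; rewrite lpermM.
by rewrite -{1}(subrKC x y) (equivariantW ln gE)// -fE// lpermK subrKC.
Qed.

End NormalSubgroup.
End Simplicity.

(** * The norm of Q_p^d *)

Section Vnorm.
Variables (p n : nat).
Implicit Types (h : 'rV[Qp p]_n) (r : rat).

Lemma Qp_vnorm_ltP h r : 0 < r ->
  reflect (forall i, Qp_abs (h 0 i) < r) (Qp_vnorm h < r).
Proof.
move=> r0; apply: (iffP (bigmax_ltP _ _ _ _)) => [[_ H] i|H]; first exact: H.
by split=> // i _; exact: H.
Qed.

Lemma Qp_vnorm_ge0 h : 0 <= Qp_vnorm h.
Proof. exact: bigmax_ge_id. Qed.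

Lemma Qp_vnorm_gt0 h r : Qp_vnorm h < r -> 0 < r.
Proof. exact: le_lt_trans (Qp_vnorm_ge0 h). Qed.

Lemma Qp_vnorm0 : Qp_vnorm (0 : 'rV[Qp p]_n) = 0.
Proof.
apply/eqP; rewrite eq_le Qp_vnorm_ge0 andbT.
by apply: bigmax_le => // i _; rewrite mxE Qp_abs0.
Qed.

Lemma Qp_vnormN h : Qp_vnorm (- h) = Qp_vnorm h.
Proof. by apply: eq_bigr => i _; rewrite mxE Qp_absN. Qed.

Lemma Qp_vnorm_ltD h h' r :
  Qp_vnorm h < r -> Qp_vnorm h' < r -> Qp_vnorm (h + h') < r.
Proof.
move=> hr h'r; have r0 := Qp_vnorm_gt0 hr.
move: hr h'r => /(Qp_vnorm_ltP _ r0) hr /(Qp_vnorm_ltP _ r0) h'r.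
apply/Qp_vnorm_ltP => // i; rewrite mxE; apply: le_lt_trans (Qp_absD _ _) _.
by rewrite gt_max hr h'r.
Qed.

Lemma Qp_vnorm_eq0 h : Qp_vnorm h = 0 -> h = 0.
Proof.
move=> h0; apply/rowP => i; rewrite mxE; apply/eqP; rewrite -Qp_abs_eq0.
rewrite eq_le Qp_abs_ge0 andbT -h0.
exact: (le_bigmax _ (fun i => Qp_abs (h 0 i))).
Qed.

End Vnorm.

Lemma small_rat (r : rat) : 0 < r -> exists n : nat, n.+1%:R^-1 < r.
Proof.
move=> r0; exists (Num.bound r^-1); rewrite invf_plt ?posrE ?ltr0n//.
have := archi_boundP (ltW (_ : 0 < r^-1)); rewrite invr_gt0 => /(_ r0).
by move/lt_trans; apply; rewrite ltr_nat.
Qed.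

(** The representatives are constant on cosets because [xget] chooses
    according to the set only. *)
Lemma coset_repr (V : zmodType) (F : filtration V) n : exists rho : V -> V,
  (forall x, F n (x - rho x)) /\ (forall x o, F n o -> rho (x + o) = rho x).
Proof.
exists (fun x => xget 0 [set y | F n (x - y)]); split=> [x|x o Fo].
  case: xgetP => [y _ //|/(_ x)]; case; rewrite /= subrr; exact: level0.
congr (xget 0 _); apply/seteqP; split=> y /= Fy.
  by have := levelB Fy Fo; rewrite addrAC addrK.
by rewrite addrAC; exact: levelD.
Qed.

(** * An absorbing filtration around Q_p^d *)

Section Model.
Variables (p d : nat).
Local Notation W := 'rV[Qp p]_d.

(** The factor [Q_p^d] carries the Lie group structure. The other factor is
    there to make the filtration absorbing: it is an infinite power of a group
    [seq nat -> Q_p^d * int] with at least as many elements as [int] times the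
    whole [model], by [encode] below. *)
Definition model : zmodType := (W * (nat -> seq nat -> W * int))%type.

Definition model_level (n : nat) : set model :=
  [set x | Qp_vnorm x.1 < n.+1%:R^-1 /\ forall i, (i < n)%N -> x.2 i = 0].

Lemma model_level0 n : model_level n 0.
Proof. by split=> //=; rewrite Qp_vnorm0 invr_gt0 ltr0n. Qed.

Lemma model_levelB n x y :
  model_level n x -> model_level n y -> model_level n (x - y).
Proof.
move=> [x1 x2] [y1 y2]; split=> [|i i_n].
  by apply: Qp_vnorm_ltD; rewrite ?Qp_vnormN.
by rewrite -[(x - y).2 i]/(x.2 i - y.2 i) x2// y2// subrr.
Qed.

Lemma model_level_decr m n : (m <= n)%N -> model_level n `<=` model_level m.
Proof.
move=> mn x [x1 x2]; split=> [|i im]; last by apply: x2; exact: leq_trans mn.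
apply: (lt_le_trans x1).
by rewrite lef_pV2 ?posrE ?ltr0n// ler_nat ltnS.
Qed.

Lemma model_level_sep x : (forall n, model_level n x) -> x = 0.
Proof.
case: x => w c H; have -> : w = 0.
  apply: Qp_vnorm_eq0; apply/eqP; rewrite eq_le Qp_vnorm_ge0 andbT leNgt.
  apply/negP => /small_rat[n nw]; have [/= wn _] := H n.
  by have := lt_trans nw wn; rewrite ltxx.
have -> : c = 0 by apply/funext => i; have [_ /= ->] := H i.+1.
by [].
Qed.

Definition model_filtration : filtration model :=
  Filtration model_level0 model_levelB model_level_decr model_level_sep.

Definition encode (i : int) (x : model) : seq nat -> W * int :=
  fun s => if s is n :: s' then x.2 n s' else (x.1, i).

Lemma encode_inj i i' x x' : encode i x = encode i' x' -> i = i' /\ x = x'.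
Proof.
case: x x' => [w c] [w' c'] /= /funeqP E.
have [-> ->] := E [::]; split=> //; congr pair.
by apply/funext => n; apply/funext => s; exact: (E (n :: s)).
Qed.

(** Level [k] leaves the coordinate of index [k] free and level [k.+1] kills
    it. Split [x] as [rho x], a representative of its coset of level [k.+1],
    plus [x - rho x], and write the code of [i] and [rho x] in the free
    coordinate of [x - rho x]. The result is in level [k], it determines [i] and
    [x], and it is equivariant at level [k.+1] because [rho] is invariant. *)
Lemma model_absorbing : absorbing model_filtration.
Proof.
move=> k; have [rho [rhoF rhoE]] := coset_repr model_filtration k.+1.
pose e (i : int) (x : model) : model :=
  (0, fun n => if n == k then encode i (rho x) else 0).
exists (fun i x => (x - rho x) + e i x), k.+1; split.
- move=> i x; apply: levelD.
    exact: (level_decr (leqnSn k) (rhoF x)).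
  split=> /= [|j jk]; first by rewrite Qp_vnorm0 invr_gt0 ltr0n.
  by rewrite (ltn_eqF jk).
- move=> i i' x x' E.
  have ek j y : (y - rho y + e j y).2 k = encode j (rho y).
    rewrite -[LHS]/((y - rho y).2 k + (e j y).2 k) (proj2 (rhoF y) k)// add0r.
    by rewrite /e /= eqxx.
  have [ii' rr'] : i = i' /\ rho x = rho x'.
    by apply: encode_inj; rewrite -!ek E.
  split=> //; move: E; rewrite /e ii' rr' => /addIr/addIr.
  exact.
- by move=> i x o Fo; rewrite /e rhoE// [x + o - _]addrAC [RHS]addrAC.
Qed.

End Model.

(** * The topology making Q_p^d an open subgroup *)

Definition model_group (p d : nat) : Type := lperm (model_filtration p d).

HB.instance Definition _ (p d : nat) := Group.on (model_group p d).

Section Topology.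
Variables (p d : nat).
Local Notation W := 'rV[Qp p]_d.
Local Notation G := (model_group p d).

Definition shift (w : W) : G := translation _ (w, 0).

Lemma shiftD u v : shift (u + v) = (shift u * shift v)%g.
Proof.
by rewrite -translationD; congr translation; congr pair; rewrite addr0.
Qed.

Lemma shift0 : shift 0 = 1%g. Proof. exact: translation0. Qed.

Lemma shiftN v : shift (- v) = (shift v)^-1%g.
Proof.
by rewrite -translationN; congr translation; congr pair; rewrite oppr0.
Qed.

Lemma shift_inj : injective shift.
Proof. by move=> u v /translation_inj[]. Qed.

(** Levels contain all sufficiently small vectors of [Q_p^d]. *)
Lemma shift_commute (g : G) : exists2 r : rat, 0 < r &
  forall w, Qp_vnorm w < r -> commute g (shift w).
Proof.
have [n gE] := lperm_equivariant g; exists n.+1%:R^-1.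
  by rewrite invr_gt0.
by move=> w wn; apply: translation_commute gE _; split.
Qed.

(** The group topology for which [shift] is an open embedding. Conjugations are
    continuous because each element commutes with all small shifts. *)
Definition model_group_nbhs (g : G) : set_system G :=
  [set S | exists2 r : rat, 0 < r &
    forall w, Qp_vnorm w < r -> S (g * shift w)%g].

HB.instance Definition _ := hasNbhs.Build G model_group_nbhs.

Lemma model_group_nbhs_filter (g : G) : ProperFilter (nbhs g).
Proof.
have H r : 0 < r -> Qp_vnorm (0 : W) < r by rewrite Qp_vnorm0.
split; last split.
- by move=> [r /H r0 /(_ _ r0)].
- by exists 1.
- move=> A B [r r0 rA] [s s0 sB]; exists (Num.min r s).
    by rewrite lt_min r0.
  by move=> w; rewrite lt_min => /andP[/rA ? /sB ?].
- by move=> A B AB [r r0 rA]; exists r => // w /rA/AB.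
Qed.

Lemma model_group_nbhs_singleton (g : G) (S : set G) : nbhs g S -> S g.
Proof.
by move=> [r r0 rS]; rewrite -[g]mulg1 -shift0; apply: rS; rewrite Qp_vnorm0.
Qed.

Lemma model_group_nbhs_nbhs (g : G) (S : set G) : nbhs g S -> nbhs g (nbhs^~ S).
Proof.
move=> [r r0 rS]; exists r => // w wr; exists r => // v vr.
by rewrite -mulgA -shiftD; apply/rS/Qp_vnorm_ltD.
Qed.

HB.instance Definition _ := Nbhs_isNbhsTopological.Build G
  model_group_nbhs_filter model_group_nbhs_singleton model_group_nbhs_nbhs.

Lemma model_group_nbhsP (g : G) (S : set G) : nbhs g S <->
  exists2 r : rat, 0 < r & forall w, Qp_vnorm w < r -> S (g * shift w)%g.
Proof. by []. Qed.

Lemma model_group_mulg_continuous :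
  continuous (fun xy : G * G => (xy.1 * xy.2)%g).
Proof.
move=> [g h] S [r r0 rS] /=; have [s s0 sh] := shift_commute h.
pose U x : set G :=
  [set (x * shift w)%g | w in [set w | Qp_vnorm w < Num.min r s]].
have Unbhs x : nbhs x (U x).
  exists (Num.min r s); first by rewrite lt_min r0.
  by move=> w wr; exists w.
exists (U g, U h); first by split; exact: Unbhs.
move=> _ [[/= u u_rs <-] [v v_rs <-]] /=.
move: u_rs v_rs; rewrite /= !lt_min => /andP[ur us] /andP[vr _].
rewrite mulgA -[(g * _ * h)%g]mulgA -(sh u us) mulgA -mulgA -shiftD.
by apply/rS/Qp_vnorm_ltD.
Qed.

Lemma model_group_invg_continuous : continuous (fun x : G => x^-1%g).
Proof.
move=> g S [r r0 rS]; have [s s0 sg] := shift_commute g^-1%g.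
exists (Num.min r s); first by rewrite lt_min r0.
move=> w; rewrite lt_min -Qp_vnormN => /andP[wr ws].
by rewrite /= invgM -shiftN -sg//; exact: rS.
Qed.

HB.instance Definition _ := isTopologicalGroup.Build G
  model_group_mulg_continuous model_group_invg_continuous.

End Topology.

(** * Analyticity of affine maps *)

Lemma Qp_row_nbhsP p n (v : 'rV[Qp p]_n) (S : set 'rV[Qp p]_n) : nbhs v S <->
  exists2 r : rat, 0 < r & forall h, Qp_vnorm h < r -> S (v + h).
Proof.
have ballE (x y : Qp p) (r : rat) : ball x r y <-> Qp_abs (y - x) < r.
  by rewrite ballEmdist -Qp_absN opprB.
split.
  move=> /nbhs_ballP[r /= r0 rS]; exists r => // h /(Qp_vnorm_ltP _ r0) hr.
  apply: rS; split=> // i j; rewrite ord1 mxE; apply/ballE.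
  by rewrite addrAC subrr add0r.
move=> [r r0 rS]; apply/nbhs_ballP; exists r => //= w [_ vw].
rewrite -[w](subrKC v); apply: rS; apply/Qp_vnorm_ltP => // i.
by rewrite !mxE; apply/ballE/vw.
Qed.

Lemma Qp_abs_sum p (I : Type) (s : seq I) (F : I -> Qp p) :
  Qp_abs (\sum_(i <- s) F i) <= \sum_(i <- s) Qp_abs (F i).
Proof.
elim/big_ind2: _ => // [|x2 x1 y2 y1 x12 y12]; first by rewrite Qp_abs0.
apply: le_trans (Qp_absD _ _) _; rewrite ge_max.
have x20 : 0 <= x2 := le_trans (Qp_abs_ge0 _) x12.
have y20 : 0 <= y2 := le_trans (Qp_abs_ge0 _) y12.
by rewrite (le_trans x12) ?lerDl// (le_trans y12) ?lerDr.
Qed.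

Section Affine.
Variables (p n m : nat).
Local Notation K := (Qp p).

(** The coefficients of the power series [y + \sum_i b i * h i]: the
    first indicator selects the exponent 0, the others the exponents of the
    single variables. *)
Definition affine_coef (y : K) (b : 'I_n -> K) (a : 'I_n -> nat) : K :=
  y *+ [forall i, a i == 0%N] + \sum_i b i *+ [forall k, a k == (k == i)].

Lemma affine_coef_gt1 y b a : (1 < \sum_i a i)%N -> affine_coef y b a = 0.
Proof.
move=> a1; rewrite /affine_coef big1 ?addr0 => [|i _].
  case: forallP => // a0; move: a1; rewrite big1 // => i _.
  by apply/eqP.
case: forallP => // ai; move: a1.
rewrite (eq_bigr (fun k => (k == i) : nat)) => [|k _]; last exact/eqP.
by rewrite (bigD1 i) //= eqxx big1 // => k /negbTE ->.
Qed.

Lemma affine_coef_le y b a :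
  Qp_abs (affine_coef y b a) <= Qp_abs y + \sum_i Qp_abs (b i).
Proof.
have ind (x : K) (t : bool) : Qp_abs (x *+ t) <= Qp_abs x.
  by case: t; rewrite // mulr0n Qp_abs0 Qp_abs_ge0.
have s0 : 0 <= \sum_i Qp_abs (b i) by apply: sumr_ge0 => i _; exact: Qp_abs_ge0.
apply: le_trans (Qp_absD _ _) _; rewrite ge_max; apply/andP; split.
  by rewrite (le_trans (ind _ _))// lerDl.
apply: le_trans (Qp_abs_sum _ _) _; rewrite -[leLHS]add0r lerD ?Qp_abs_ge0//.
by apply: ler_sum => i _; exact: ind.
Qed.

Lemma affine_coef_sum y b (h : 'I_n -> K) N :
  \sum_(a : {ffun 'I_n -> 'I_N.+2})
    affine_coef y b (fun i => a i : nat) * \prod_i h i ^+ a i =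
  y + \sum_i h i * b i.
Proof.
under eq_bigr => a _ do rewrite mulrDl mulr_suml.
rewrite big_split /= exchange_big /=; congr (_ + _).
  pose a0 : {ffun 'I_n -> 'I_N.+2} := [ffun=> ord0].
  rewrite (bigD1 a0) //= [X in _ + X]big1 => [|a aa0].
    rewrite addr0; have -> : [forall i, nat_of_ord (a0 i) == 0%N].
      by apply/forallP => i; rewrite ffunE.
    by rewrite big1 ?mulr1// => i _; rewrite ffunE.
  case: forallP => [H|_]; last by rewrite mul0r.
  case/eqP: aa0; apply/ffunP => i; rewrite ffunE; apply/val_inj/eqP; exact: H.
apply: eq_bigr => i _.
pose e : {ffun 'I_n -> 'I_N.+2} := [ffun k => inord (k == i)].
have eE k : e k = (k == i) :> nat.
  by rewrite ffunE inordK //; case: (k == i).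
rewrite (bigD1 e) //= [X in _ + X]big1 => [|a ae].
  rewrite addr0; have -> : [forall k, nat_of_ord (e k) == (k == i)].
    by apply/forallP => k; rewrite eE.
  rewrite mulrC (bigD1 i) //= eE eqxx expr1 big1 ?mulr1// => k /negbTE ki.
  by rewrite eE ki.
case: forallP => [H|_]; last by rewrite mul0r.
by case/eqP: ae; apply/ffunP => k; apply/val_inj; rewrite /= eE; apply/eqP/H.
Qed.

Lemma affine_analytic (f : 'rV[K]_n -> 'rV[K]_m) x y (A : 'M[K]_(n, m)) r :
  0 < r -> (forall h, Qp_vnorm h < r -> f (x + h) = y + h *m A) ->
  analytic_at f x.
Proof.
move=> r0 fE j; exists (affine_coef (y 0 j) (A^~ j)), r; split=> //; split.
  exists ((Qp_abs (y 0 j) + \sum_i Qp_abs (A i j)) * (1 + r)) => a.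
  have M0 : 0 <= Qp_abs (y 0 j) + \sum_i Qp_abs (A i j).
    by rewrite addr_ge0 ?Qp_abs_ge0// sumr_ge0// => i _; exact: Qp_abs_ge0.
  case: (ltnP 1 (\sum_i a i)) => a1.
    by rewrite affine_coef_gt1// Qp_abs0 mul0r mulr_ge0// addr_ge0// ltW.
  apply: ler_pM; rewrite ?Qp_abs_ge0 ?exprn_ge0 ?(ltW r0) ?affine_coef_le//.
  case: (\sum_i a i)%N a1 => [|[|]]// _;
    by rewrite ?expr0 ?expr1 ?lerDl ?lerDr// ltW.
(* Boxes of side at least 2 already contain all the exponents that matter. *)
move=> h hr; apply: cvg_near_cst; exists 2%N => // -[|[|N]] //= _.
by rewrite affine_coef_sum fE// !mxE.
Qed.

End Affine.

(** * The Lie group structure *)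

Section Charts.
Variables (p d : nat).
Local Notation W := 'rV[Qp p]_d.
Local Notation G := (model_group p d).

Section ChartAt.
Variable g : G.

(** The chart at [g] is the coset of [g] modulo the open subgroup [Q_p^d],
    read through [w |-> g * shift w]. *)
Definition coset_dom : set G := range (fun w : W => (g * shift w)%g).
Definition coset_coord (x : G) : W := xget 0 [set w | (g * shift w)%g = x].
Definition coset_point (w : W) : G := (g * shift w)%g.

Lemma coset_coordE w : coset_coord (g * shift w)%g = w.
Proof.
rewrite /coset_coord; case: xgetP => [v _ /= E|/(_ w)]; last by case.
by apply: (@shift_inj p d); rewrite -(mulKg g (shift v)) E mulKg.
Qed.

Lemma coset_dom_open : open coset_dom.
Proof.
rewrite openE => _ [w _ <-]; apply/model_group_nbhsP; exists 1 => // v _.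
by exists (w + v); rewrite // shiftD mulgA.
Qed.

Lemma coset_im_open : open (coset_coord @` coset_dom).
Proof.
suff -> : coset_coord @` coset_dom = setT by exact: openT.
rewrite -subTset => w _; exists (g * shift w)%g; last exact: coset_coordE.
by exists w.
Qed.

Lemma coset_coordK x : coset_dom x -> coset_point (coset_coord x) = x.
Proof. by move=> [w _ <-]; rewrite coset_coordE. Qed.

Lemma coset_coordM x w : coset_dom x ->
  coset_coord (x * shift w)%g = coset_coord x + w.
Proof. by move=> [v _ <-]; rewrite -mulgA -shiftD !coset_coordE. Qed.

Lemma coset_pointD x w : coset_dom x ->
  coset_point (coset_coord x + w) = (x * shift w)%g.
Proof. by move=> [v _ <-]; rewrite coset_coordE /coset_point shiftD mulgA. Qed.

Lemma coset_coord_continuous x : coset_dom x -> {for x, continuous coset_coord}.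
Proof.
move=> gx S /Qp_row_nbhsP[r r0 rS].
apply/model_group_nbhsP; exists r => // w wr.
by rewrite /= coset_coordM//; exact: rS.
Qed.

Lemma coset_point_continuous x : coset_dom x ->
  {for coset_coord x, continuous coset_point}.
Proof.
move=> gx S /model_group_nbhsP[r r0]; rewrite coset_coordK// => rS.
apply/Qp_row_nbhsP; exists r => // w wr.
by rewrite /= coset_pointD//; exact: rS.
Qed.

Definition coset_chart : Qp_chart p d G := QpChart coset_dom_open coset_im_open
  coset_coordK coset_coord_continuous coset_point_continuous.

End ChartAt.

Definition coset_atlas : set (Qp_chart p d G) := range coset_chart.

Lemma coset_atlas_cover (x : G) : exists2 c, coset_atlas c & chart_dom c x.
Proof.
exists (coset_chart x); first by exists x.
by exists 0 => //; rewrite shift0 mulg1.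
Qed.

(** In the coset charts everything is affine: at a point [x] a chart reads
    [x * shift w] as a constant plus [w], and multiplication and inversion turn
    small shifts into their sum and opposite, again because they commute with
    the given elements. *)
Lemma coset_atlas_compat c1 c2 : coset_atlas c1 -> coset_atlas c2 ->
  forall x, chart_dom c1 x -> chart_dom c2 x ->
  analytic_at (fun v => c2 (chart_inv c1 v)) (c1 x).
Proof.
move=> [g1 _ <-] [g2 _ <-] x /= g1x g2x.
apply: (@affine_analytic _ _ _ _ _ (coset_coord g2 x) 1%:M 1) => // h _.
by rewrite coset_pointD// coset_coordM// mulmx1.
Qed.

Lemma coset_mul_analytic c1 c2 c3 :
  coset_atlas c1 -> coset_atlas c2 -> coset_atlas c3 ->
  forall x y, chart_dom c1 x -> chart_dom c2 y -> chart_dom c3 (x * y)%g ->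
  analytic_at (fun v : 'rV[Qp p]_(d + d) =>
      c3 (chart_inv c1 (lsubmx v) * chart_inv c2 (rsubmx v))%g)
    (row_mx (c1 x) (c2 y)).
Proof.
move=> [g1 _ <-] [g2 _ <-] [g3 _ <-] x y /= g1x g2y g3xy.
have [r r0 ry] := shift_commute y.
apply: (@affine_analytic _ _ _ _ _ (coset_coord g3 (x * y)%g)
  (col_mx 1%:M 1%:M) r) => // h hr.
rewrite !linearD /= row_mxKl row_mxKr !coset_pointD//.
have hl : Qp_vnorm (lsubmx h) < r.
  move/(Qp_vnorm_ltP _ r0): hr => hr.
  by apply/Qp_vnorm_ltP => // i; rewrite mxE.
rewrite mulgA -[(x * _ * y)%g]mulgA -(ry _ hl) mulgA -mulgA -shiftD.
by rewrite coset_coordM// -[h in RHS]hsubmxK mul_row_col !mulmx1.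
Qed.

Lemma coset_inv_analytic c1 c2 : coset_atlas c1 -> coset_atlas c2 ->
  forall x, chart_dom c1 x -> chart_dom c2 x^-1%g ->
  analytic_at (fun v => c2 (chart_inv c1 v)^-1%g) (c1 x).
Proof.
move=> [g1 _ <-] [g2 _ <-] x /= g1x g2x.
have [r r0 rx] := shift_commute x^-1%g.
apply: (@affine_analytic _ _ _ _ _ (coset_coord g2 x^-1%g) (- 1%:M) r) => //.
move=> h hr.
rewrite coset_pointD// invgM -shiftN -rx ?Qp_vnormN// coset_coordM//.
by rewrite mulmxN mulmx1.
Qed.

Definition model_lie : padicLieGroup p d := PadicLieGroup coset_atlas_cover
  coset_atlas_compat coset_mul_analytic coset_inv_analytic.

Lemma model_lie_trivial_adjoint : trivial_adjoint model_lie.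
Proof.
move=> g _ [k _ <-] /= k1 e e0; have [r r0 rg] := shift_commute g.
exists r => // h hr; rewrite /= coset_pointD// coset_coordK// mul1g mulg1 mulgV.
rewrite (rg h hr) mulgK -[shift h]mul1g coset_coordM// mulmx1.
by rewrite addrAC addrK subrr Qp_vnorm0 mulr_ge0 ?Qp_vnorm_ge0// ltW.
Qed.

Lemma model_lie_quasi_center : quasi_center model_lie = setT.
Proof.
rewrite -subTset => g _; have [r r0 rg] := shift_commute g.
exists [set shift w | w in [set w | Qp_vnorm w < r]]; split.
- rewrite openE => _ [w /= wr <-]; apply/model_group_nbhsP; exists r => // v vr.
  by exists (w + v); rewrite ?shiftD//=; exact: Qp_vnorm_ltD.
- split=> [|_ _ [u /= ur <-] [v /= vr <-]|_ [u /= ur <-]].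
  + by exists 0; rewrite ?shift0//= Qp_vnorm0.
  + by exists (u + v); rewrite ?shiftD//=; exact: Qp_vnorm_ltD.
  + by exists (- u); rewrite ?shiftN//= Qp_vnormN.
- by move=> _ [w /= wr <-]; exact: rg.
Qed.

End Charts.

(** * Extraordinariness *)

Lemma Qp_abs_small (p : nat) : prime p -> forall r : rat, 0 < r ->
  exists2 x : Qp p, x != 0 & Qp_abs x < r.
Proof.
move=> pp r /small_rat[n nr]; pose q : rat := (p ^ n.+1)%:R.
have pn0 : (0 < p ^ n.+1)%N by rewrite expn_gt0 prime_gt0.
have absq : padic_abs p q = (p ^ n.+1)%:R^-1.
  have -> : q = (p ^ n.+1)%:Z%:~R / 1%:~R by rewrite divr1.
  rewrite padic_abs_frac// /padic_absz /= logn1 expn0 invr1 divr1.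
  by rewrite eqz_nat -leqn0 leqNgt pn0 pfactorK.
exists (ratr q).
  by rewrite -Qp_abs_eq0 Qp_abs_ratr absq invr_eq0 pnatr_eq0 -lt0n.
rewrite Qp_abs_ratr absq; apply: lt_trans nr.
by rewrite ltf_pV2 ?posrE ?ltr0n// ltr_nat ltn_expl// prime_gt1.
Qed.

Section Extraordinary.
Variables (p d : nat).
Hypotheses (pp : prime p) (d0 : (0 < d)%N).
Local Notation G := (model_lie p d).

Lemma model_lie_nbhs1 (S : set G) : nbhs 1%g S -> exists2 g, S g & g <> 1%g.
Proof.
move=> /model_group_nbhsP[r r0 rS]; have [x x0 xr] := Qp_abs_small pp r0.
exists (shift (const_mx x)).
  by rewrite -[shift _]mul1g; apply/rS/Qp_vnorm_ltP => // i; rewrite mxE.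
rewrite -(shift0 p d) => /shift_inj/rowP/(_ (Ordinal d0)).
by rewrite !mxE => /eqP; apply/negP.
Qed.

Lemma model_lie_not_discrete : ~ discrete_subset [set: G].
Proof.
move=> /(_ 1%g I)[_ [S /model_lie_nbhs1[g Sg g1]]].
by rewrite setIT => S1; rewrite S1 in Sg.
Qed.

Lemma model_lie_simple (H : set G) : is_subgroup H ->
  (forall x g, H x -> H (x ^ g)%g) ->
  H = setT \/ H = [set 1%g].
Proof.
move=> [H1 HM HV] HJ.
have [[h [Hh h1]]|nH] := pselect (exists h, H h /\ h <> 1%g).
  by left; exact: (normal_full (@model_absorbing p d) H1 HM HV HJ Hh h1).
right; apply/seteqP; split=> [h Hh|_ ->//] /=.
by apply: contrapT => h1; apply: nH; exists h.
Qed.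

Lemma model_lie_subnormal (H : set G) :
  subnormal H -> H = setT \/ H = [set 1%g].
Proof.
elim=> [|{}H K _ [->|->] subH [HK HN]]; first by left.
  by apply: model_lie_simple => // x g Hx; exact: HN.
have [H1 _ _] := subH; right; apply/seteqP; split=> // _ ->; exact: H1.
Qed.

Lemma generated_subgroup (T : topologicalGroupType) (A : set T) :
  is_subgroup (generated A).
Proof.
split=> [H []//|x y Ax Ay H subH AH|x Ax H subH AH].
  by case: (subH) => _ HM _; apply: HM; [exact: Ax|exact: Ay].
by case: (subH) => _ _ HV; apply: HV; exact: Ax.
Qed.

(** By simplicity: the derived subgroup is normal, and not trivial because
    swaps do not commute with all translations. *)
Lemma derived_full : derived_subgroup [set: G] = setT.
Proof.
have comm x y : derived_subgroup [set: G] [~ x, y]%g.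
  by move=> H _; apply; exists x, y.
have subD := generated_subgroup (T := G)
  [set z | exists x y, [/\ [set: G] x, [set: G] y & z = [~ x, y]%g]].
have [|//|D1] := model_lie_simple subD.
  move=> x g Dx; rewrite -[(x ^ g)%g](mulVKg x) -commgEl.
  by case: subD => _ DM _; exact: DM Dx (comm x g).
have [f [g]] := lperm_noncommutative (@model_absorbing p d); case.
by apply/commgP/eqP; move: (comm f g); rewrite /derived_subgroup D1.
Qed.

Lemma model_lie_extraordinary : extraordinary G.
Proof.
split.
- move=> H _ _ /model_lie_subnormal[->|->]; first by left; exact: openT.
  right=> _ ->; split; first by apply/mem_set.
  by exists setT; [exact: filterT|rewrite setTI].
- exact: model_lie_trivial_adjoint.
- exact: model_lie_quasi_center.
- move=> H oH _ /model_lie_subnormal[HE|HE].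
    by rewrite HE derived_full; exact: model_lie_not_discrete.
  have /model_lie_nbhs1[g] : nbhs (1%g : G) H.
    by apply: open_nbhs_nbhs; split=> //; rewrite HE.
  by rewrite HE.
Qed.

End Extraordinary.

Theorem corollary1p3 (d p : nat) (hd : (1 <= d)%N) (hp : prime p) :
  exists G : padicLieGroup p d, extraordinary G.
Proof. by exists (model_lie p d); exact: model_lie_extraordinary. Qed.
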